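(* Let $d\ge 2$. The maximal number of lattice points on an edge of a $d$-dimensional reflexive simplex is $2t_{d-1}+1$, and this number is attained only for the reflexive simplex $S_{Q'_d}$ (up to unimodular equivalence).
   Context: Let $M,N$ be dual lattices of rank $d\ge 2$ with pairing $\langle\cdot,\cdot\rangle: M\times N\to\mathbb{Z}$, and $M_{\mathbb{R}}=M\otimes_{\mathbb Z}\mathbb{R}$, $N_{\mathbb{R}}=N\otimes_{\mathbb Z}\mathbb{R}$. A lattice polytope in $M_{\mathbb R}$ is a polytope whose vertices lie in $M$; lattice points are points of $M$. Two lattice polytopes are isomorphic (unimodularly equivalent) if there is a lattice isomorphism inducing an affine bijection between their affine hulls that maps the faces of one onto the faces of the other. A reflexive polytope $P\subseteq M_{\mathbb R}$ is a $d$-dimensional lattice polytope containing the origin in its interior such that its dual polytope $P^*=\{x\in N_{\mathbb R}: \langle y,x\rangle\ge -1\ \forall y\in P\}$ is also a lattice polytope. A reflexive simplex is a reflexive polytope that is a simplex. Sylvester sequence: $y_0=2$, $y_n=1+y_0\cdots y_{n-1}$ for $n\ge1$; and $t_n=y_n-1$ for $n\ge 0$. The enlarged Sylvester weight system of length $d$ is the $(d+1)$-tuple $$Q'_d=\left(\frac{2t_{d-1}}{y_0},\ldots,\frac{2t_{d-1}}{y_{d-2}},1,1\right).$$ For a $(d+1)$-tuple $Q=(q_0,\ldots,q_d)$ of positive integers with $q_d=1$, put $|Q|=q_0+\cdots+q_d$; if $k_i=|Q|/q_i$ is an integer for all $i=0,\ldots,d-1$, define $$S_Q=\mathrm{conv}(k_0e_0-u,\ldots,k_{d-1}e_{d-1}-u,-u),\qquad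 u=e_0+\cdots+e_{d-1},$$ where $e_0,\ldots,e_{d-1}$ is a $\mathbb{Z}$-basis of $M$. *)

(* Defs.v *)
(* Coordinates are fixed once and for all: M = N = Z^d,
   M_R = N_R = 'rV[R]_d, and the pairing is the standard dot product. *)
From mathcomp Require Import all_boot all_order all_algebra.
From mathcomp Require Import all_classical all_reals all_analysis.

Set Implicit Arguments.
Unset Strict Implicit.
Unset Printing Implicit Defensive.

Import Order.TTheory GRing.Theory Num.Theory.
Import numFieldNormedType.Exports.

Local Open Scope classical_set_scope.
Local Open Scope ring_scope.

Section Polytopes.
Variables (R : realType) (d : nat).
Local Notation V := 'rV[R]_d.

Definition pairing (y x : V) : R := \sum_(i < d) y 0 i * x 0 i.

Definition lattice : set V := range (fun m : 'rV[int]_d => map_mx intr m).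

Definition conv n (p : 'I_n -> V) : set V :=
  [set x | exists a : 'I_n -> R, [/\ forall i, 0 <= a i,
     \sum_(i < n) a i = 1 & x = \sum_(i < n) a i *: p i]].

Definition affine_hull (A : set V) : set V :=
  [set x | exists n (p : 'I_n -> V) (a : 'I_n -> R),
     [/\ forall i, A (p i), \sum_(i < n) a i = 1
       & x = \sum_(i < n) a i *: p i]].

Definition affinely_independent n (p : 'I_n -> V) : Prop :=
  forall a : 'I_n -> R, \sum_(i < n) a i = 0 ->
    \sum_(i < n) a i *: p i = 0 -> forall i, a i = 0.

Definition has_dim (A : set V) (k : nat) : Prop :=
  exists p : 'I_k.+1 -> V, [/\ affinely_independent p,
    forall i, A (p i) & A `<=` affine_hull (range p)].

Definition polytope (P : set V) : Prop :=
  exists n (p : 'I_n -> V), P = conv p.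

(* [c = 0] is allowed, so set0 and P itself are faces of P. *)
Definition face (P F : set V) : Prop :=
  exists (c : V) (b : R), (forall x, P x -> pairing c x <= b) /\
    F = P `&` [set x | pairing c x = b].

Definition vertex (P : set V) (v : V) : Prop := face P [set v].

Definition edge (P E : set V) : Prop := face P E /\ has_dim E 1.

Definition simplex (P : set V) : Prop :=
  exists k (p : 'I_k.+1 -> V), affinely_independent p /\ P = conv p.

Definition lattice_polytope (P : set V) : Prop :=
  polytope P /\ forall v, vertex P v -> lattice v.

Definition dual (P : set V) : set V :=
  [set x | forall y, P y -> -1 <= pairing y x].

Definition reflexive (P : set V) : Prop :=
  [/\ lattice_polytope P, has_dim P d, interior P 0
    & lattice_polytope (dual P)].

Definition reflexive_simplex (P : set V) : Prop := reflexive P /\ simplex P.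

(* The lattice isomorphism is a linear automorphism U of Z^d, without
   translation.  For reflexive polytopes this is no restriction: 0 is their only
   interior lattice point, hence an affine unimodular equivalence fixes it. *)
Definition unimodularly_equivalent (P P' : set V) : Prop :=
  exists2 U : 'M[int]_d, U \in unitmx &
    let phi := fun x : V => x *m map_mx intr U in
    set_bij (affine_hull P) (affine_hull P') phi /\
    [set phi @` F | F in face P] = face P'.

End Polytopes.

(* The sequence [:: y_0; ...; y_(n-1)]; the empty product gives y_0 = 2. *)
Fixpoint sylvester_prefix (n : nat) : seq nat :=
  if n is m.+1 then
    let s := sylvester_prefix m in rcons s (1 + \prod_(y <- s) y)%N
  else [::].

Definition sylvester (n : nat) : nat :=
  (1 + \prod_(y <- sylvester_prefix n) y)%N.

Definition sylvester_t (n : nat) : nat := (sylvester n - 1)%N.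

Lemma sylvester0 : sylvester 0 = 2%N.
Proof. by rewrite /sylvester big_nil. Qed.

Lemma sylvesterE n : sylvester n = (1 + \prod_(i < n) sylvester i)%N.
Proof.
rewrite {1}/sylvester; congr addn.
elim: n => [|n IHn]; first by rewrite big_nil big_ord0.
by rewrite big_ord_recr -IHn [sylvester_prefix _]/= -cats1 big_cat big_seq1.
Qed.

(* Entries 0, ..., d-2 are 2 t_(d-1) / y_i (an exact division, see below);
   entries d-1 and d are 1. *)
Definition enlarged_sylvester (d : nat) : 'I_d.+1 -> nat :=
  fun i => if (i < d.-1)%N then ((2 * sylvester_t d.-1) %/ sylvester i)%N
           else 1%N.

Definition total_weight (d : nat) (Q : 'I_d.+1 -> nat) : nat :=
  (\sum_(i < d.+1) Q i)%N.

(* Only meaningful for positive Q with last entry 1 and with all quotients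
   |Q| / q_i integral; lemmas below check this for [enlarged_sylvester]. *)
Section WeightSimplex.
Variables (R : realType) (d : nat) (Q : 'I_d.+1 -> nat).

Let e (j : 'I_d) : 'rV[R]_d := delta_mx 0 j.
Let u : 'rV[R]_d := \sum_(j < d) e j.
Let k (i : 'I_d.+1) : R := (total_weight Q)%:R / (Q i)%:R.

(* [unlift ord_max i] is [Some j] iff i has the value of j : 'I_d, and [None]
   iff i is the last index d. *)
Definition weight_simplex_vertex (i : 'I_d.+1) : 'rV[R]_d :=
  if unlift ord_max i is Some j then k i *: e j - u else - u.

Definition weight_simplex : set 'rV[R]_d := conv weight_simplex_vertex.

End WeightSimplex.

Lemma sylvester_tE n : sylvester_t n = (\prod_(i < n) sylvester i)%N.
Proof. by rewrite /sylvester_t sylvesterE add1n subn1. Qed.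

Lemma sylvester_gt0 n : (0 < sylvester n)%N.
Proof. by rewrite /sylvester add1n. Qed.

Lemma sylvester_t_gt0 n : (0 < sylvester_t n)%N.
Proof. by rewrite sylvester_tE; apply: prodn_gt0 => i; apply: sylvester_gt0. Qed.

Lemma sylvester_dvd i n : (i < n)%N -> (sylvester i %| sylvester_t n)%N.
Proof.
by move=> ltin; rewrite sylvester_tE (bigD1 (Ordinal ltin)) //= dvdn_mulr.
Qed.

Lemma sylvester_egyptian n :
  (\sum_(i < n) sylvester_t n %/ sylvester i + 1 = sylvester_t n)%N.
Proof.
elim: n => [|n IHn]; first by rewrite big_ord0 sylvester_tE big_ord0.
have tS : sylvester_t n.+1 = (sylvester_t n * sylvester n)%N.
  by rewrite !sylvester_tE big_ord_recr.
have yE : sylvester n = (sylvester_t n).+1.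
  by rewrite /sylvester_t subn1 prednK // sylvester_gt0.
rewrite big_ord_recr /= tS mulnK ?sylvester_gt0 //.
under eq_bigr => i _ do rewrite -divn_mulAC ?sylvester_dvd //.
rewrite -big_distrl /= -addnA addn1 -yE -{2}[sylvester n]mul1n.
by rewrite -mulnDl IHn.
Qed.

Lemma enlarged_sylvester_gt0 d (i : 'I_d.+1) : (0 < enlarged_sylvester i)%N.
Proof.
rewrite /enlarged_sylvester; case: ifP => // ltid.
rewrite divn_gt0 ?sylvester_gt0 // (leq_trans (dvdn_leq _ (sylvester_dvd ltid))) //.
  exact: sylvester_t_gt0.
by rewrite leq_pmull.
Qed.

Lemma enlarged_sylvester_last d : @enlarged_sylvester d ord_max = 1%N.
Proof. by rewrite /enlarged_sylvester /= ltnNge leq_pred. Qed.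

Lemma enlarged_sylvester_total d : (0 < d)%N ->
  total_weight (@enlarged_sylvester d) = (2 * sylvester_t d.-1)%N.
Proof.
case: d => // d _; rewrite /total_weight !big_ord_recr /= /enlarged_sylvester /=.
rewrite ltnn ltnNge leqnSn /=.
under eq_bigr => i _ do rewrite ltn_ord -muln_divA ?sylvester_dvd //.
by rewrite -big_distrr /= -addnA -[(1 + 1)%N]/(2 * 1)%N -mulnDr sylvester_egyptian.
Qed.

Lemma enlarged_sylvester_dvd d (i : 'I_d.+1) : (0 < d)%N ->
  (enlarged_sylvester i %| total_weight (@enlarged_sylvester d))%N.
Proof.
move=> d_gt0; rewrite enlarged_sylvester_total // /enlarged_sylvester.
case: ifP => // ltid; apply/dvdnP; exists (sylvester i).
by rewrite [RHS]mulnC divnK // dvdn_mull // sylvester_dvd.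
Qed.

(* Main.v *)
(* Let v_0, ..., v_d be the vertices of a reflexive simplex, and (1/k_i) the
   barycentric coordinates of the origin.  The vertices eta_i of the dual satisfy
   <eta_i, v_j> = k_i [i = j] - 1, so the k_i are positive integers with
   \sum 1/k_i = 1.  Pairing a lattice point of the edge [v_a, v_b] with eta_a and
   eta_b shows that the edge has at most gcd(k_a, k_b) + 1 lattice points.  As the
   other d - 1 unit fractions sum to at most 1 - 1/t_(d-1) (Curtiss), the gcd is at
   most 2 t_(d-1); equality forces k_a = k_b = 2 t_(d-1) and the other k_i to be
   y_0, ..., y_(d-2).  Then (v_a - v_b)/k_a is a lattice point, and coprimality of
   the y_i puts every e_i = (v_i - v_b)/k_i in the lattice; they form the basis dual
   to the eta_i with i <> b, in which the simplex is S_Q'. *)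
Require Import Defs.
From mathcomp Require Import all_boot all_order all_algebra.
From mathcomp Require Import ring lra.
From mathcomp Require Import all_classical all_reals all_analysis.
(* [conv] and other names of Defs are shadowed by the libraries. *)
Import Defs.

Set Implicit Arguments.
Unset Strict Implicit.
Unset Printing Implicit Defensive.

Import Order.TTheory GRing.Theory Num.Theory.
Import numFieldNormedType.Exports.

Local Open Scope classical_set_scope.
Local Open Scope card_scope.
Local Open Scope ring_scope.

(** * Unit fractions *)

Lemma sylvester_tS n : sylvester_t n.+1 = (sylvester_t n * sylvester n)%N.
Proof. by rewrite !sylvester_tE big_ord_recr. Qed.

Lemma sylvester_tD1 n : sylvester n = (sylvester_t n).+1.
Proof. by rewrite /sylvester_t subn1 prednK // sylvester_gt0. Qed.

Lemma sylvester_coprime i j : i != j -> coprime (sylvester i) (sylvester j).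
Proof.
wlog lt_ij : i j / (i < j)%N => [IH|_].
  case: (ltngtP i j) => // [lt_ij|lt_ji] _; first by apply: IH => //; rewrite ltn_eqF.
  by rewrite coprime_sym IH // ltn_eqF.
rewrite (sylvester_tD1 j); apply: coprime_dvdl (coprimenS _).
exact: sylvester_dvd.
Qed.

Section EgyptianFractions.
Variable F : realFieldType.

(** The sum telescopes: as y_n = t_n + 1, one has 1/t_n - 1/y_n = 1/(t_n y_n) = 1/t_(n+1). *)
Lemma sum_inv_sylvester n :
  \sum_(0 <= i < n) (sylvester i)%:R^-1 = 1 - (sylvester_t n)%:R^-1 :> F.
Proof.
elim: n => [|n IHn].
  by rewrite big_nil sylvester_tE big_ord0 invr1 subrr.
have t0 : (sylvester_t n)%:R != 0 :> F by rewrite pnatr_eq0 -lt0n sylvester_t_gt0.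
have y0 : (sylvester_t n)%:R + 1 != 0 :> F by rewrite natr1 pnatr_eq0.
rewrite big_nat_recr //= IHn sylvester_tS sylvester_tD1 natrM -natr1.
by field; rewrite t0 y0.
Qed.

(** Abel summation: once the first term is peeled off, induction weights the remaining suffix sum by
    a_1; that sum is nonnegative, so lowering the weight to a_0 can only decrease the product. *)
Lemma abel_sum_ge (a c : nat -> F) n :
    (forall i j, (i <= j < n)%N -> a i <= a j) ->
    (forall k, (k <= n)%N -> 0 <= \sum_(k <= i < n) c i) ->
  a 0%N * \sum_(0 <= i < n) c i <= \sum_(0 <= i < n) a i * c i.
Proof.
elim: n a c => [|n IHn] a c a_mono c_ge0; first by rewrite !big_nil mulr0.
rewrite !big_nat_recl // mulrDr lerD2l.
apply: le_trans (IHn (a \o S) (c \o S) _ _) => [||k le_kn].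
- case: n IHn a_mono c_ge0 => [|n] _ a_mono c_ge0; first by rewrite !big_nil !mulr0.
  apply: ler_wpM2r (a_mono 0%N 1%N isT).
  by have := c_ge0 1%N isT; rewrite big_add1.
- by move=> i j /andP[le_ij lt_jn]; apply: a_mono; rewrite !ltnS le_ij.
by have := c_ge0 k.+1 le_kn; rewrite big_add1.
Qed.

(** 1 - \sum 1/a_i is a positive fraction with denominator \prod a_i, so its numerator is at least
    1. *)
Lemma prod_inv_le_sub_sum_inv (a : nat -> nat) n :
    (forall i, (i < n)%N -> (0 < a i)%N) ->
    \sum_(0 <= i < n) (a i)%:R^-1 < 1 :> F ->
  (\prod_(0 <= i < n) (a i)%:R)^-1 <= 1 - \sum_(0 <= i < n) (a i)%:R^-1 :> F.
Proof.
move=> a_gt0 sum_lt1; set p := \prod_(0 <= i < n) _; set s := \sum_(_ <= _ < _) _.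
have p_gt0 : 0 < p.
  by rewrite /p big_nat; apply: prodr_gt0 => i ltin; rewrite ltr0n a_gt0.
have [m mE] : exists m : nat, p * s = m%:R.
  rewrite /p /s; elim: n a_gt0 {p s sum_lt1 p_gt0} => [|n IHn] a_gt0.
    by exists 0%N; rewrite !big_nil mulr0.
  have [i ltin|m mE] := IHn; first by apply: a_gt0; apply: ltnW.
  have an0 : (a n)%:R != 0 :> F by rewrite pnatr_eq0 -lt0n a_gt0.
  exists (m * a n + \prod_(0 <= i < n) a i)%N.
  rewrite !big_nat_recr //= natrD natrM -mE natr_prod mulrDr mulfK //.
  by congr (_ + _); rewrite mulrAC.
rewrite -(ler_pM2l p_gt0) divff ?gt_eqF // mulrBr mulr1 mE.
have pE : p = (\prod_(0 <= i < n) a i)%:R by rewrite natr_prod.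
have : m%:R < p by rewrite -mE -[ltRHS]mulr1 ltr_pM2l.
by rewrite lerBrDr pE -[1]/(1%:R) -natrD ltr_nat ler_nat add1n.
Qed.

(* Soundararajan's argument: by induction the suffix sums of 1/a_i dominate
   those of 1/y_i, and Abel summation with the increasing weights a_i turns this
   into \sum a_i/y_i <= n.  Hence \prod a_i <= \prod y_i by AM-GM, while the
   converse holds because 1 - \sum 1/a_i is at least 1/\prod a_i. *)
Lemma curtiss (a : nat -> nat) n :
    (forall i j, (i <= j < n)%N -> (a i <= a j)%N) ->
    (forall i, (i < n)%N -> (0 < a i)%N) ->
    \sum_(0 <= i < n) (a i)%:R^-1 < 1 :> F ->
    1 - (sylvester_t n)%:R^-1 <= \sum_(0 <= i < n) (a i)%:R^-1 :> F ->
  forall i, (i < n)%N -> a i = sylvester i.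
Proof.
elim/ltn_ind: n => n IHn a_mono a_gt0 sum_lt1 sum_ge.
(* A larger prefix sum would satisfy the assumptions of the statement for k < n; the induction
   hypothesis would then identify the prefix with Sylvester's, against strictness. *)
have prefix_le k : (k < n)%N ->
    \sum_(0 <= i < k) (a i)%:R^-1 <= \sum_(0 <= i < k) (sylvester i)%:R^-1 :> F.
  move=> lt_kn; rewrite leNgt; apply/negP => lt_sum.
  suff aE i : (i < k)%N -> a i = sylvester i.
    suff sumE : \sum_(0 <= i < k) (a i)%:R^-1 =
        \sum_(0 <= i < k) (sylvester i)%:R^-1 :> F.
      by rewrite sumE ltxx in lt_sum.
    by apply: eq_big_nat => i /andP[_ /aE->].
  apply: IHn => // [i' j' /andP[le_ij lt_jk]|i' lt_ik||].
  - by apply: a_mono; rewrite le_ij (ltn_trans lt_jk).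
  - exact/a_gt0/(ltn_trans lt_ik).
  - apply: le_lt_trans sum_lt1; rewrite (big_cat_nat _ (ltnW lt_kn)) //= lerDl.
    by apply: sumr_ge0 => *; rewrite invr_ge0.
  by rewrite -sum_inv_sylvester ltW.
have suffix_ge0 k : (k <= n)%N ->
    0 <= \sum_(k <= i < n) ((a i)%:R^-1 - (sylvester i)%:R^-1) :> F.
  rewrite leq_eqVlt => /predU1P[->|lt_kn]; first by rewrite big_geq.
  have := prefix_le k lt_kn; move: sum_ge; rewrite -sum_inv_sylvester sumrB.
  rewrite 2!(big_cat_nat (leq0n k) (ltnW lt_kn)) /=; lra.
have y_gt0 i : 0 < (sylvester i)%:R :> F by rewrite ltr0n sylvester_gt0.
have sum_le : \sum_(i < n) (a i)%:R / (sylvester i)%:R <= n%:R :> F.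
  have sum0_ge0 := suffix_ge0 0%N isT.
  have := @abel_sum_ge (fun i => (a i)%:R) _ n _ suffix_ge0.
  have mono_aR i j : (i <= j < n)%N -> (a i)%:R <= (a j)%:R :> F.
    by move=> le_ij; rewrite ler_nat a_mono.
  move=> /(_ mono_aR)/(le_trans (mulr_ge0 (ler0n _ _) sum0_ge0)).
  have -> : \sum_(0 <= i < n) (a i)%:R * ((a i)%:R^-1 - (sylvester i)%:R^-1) =
      n%:R - \sum_(i < n) (a i)%:R / (sylvester i)%:R :> F.
    rewrite big_mkord -[in n%:R](card_ord n) -sumr_const -sumrB.
    apply: eq_bigr => i _.
    by rewrite mulrBr divff // pnatr_eq0 -lt0n a_gt0.
  by rewrite subr_ge0.
have r_ge0 : {in 'I_n, forall i : 'I_n, 0 <= (a i)%:R / (sylvester i)%:R :> F}.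
  by move=> i _; rewrite divr_ge0.
have [prod_le prod_eq] := leif_AGM r_ge0.
rewrite card_ord in prod_le prod_eq.
have prodE : \prod_(i < n) ((a i)%:R / (sylvester i)%:R) =
    (\prod_(0 <= i < n) (a i)%:R) / (sylvester_t n)%:R :> F.
  by rewrite big_mkord sylvester_tE natr_prod prodf_div.
have prod_ge1 : 1 <= \prod_(i < n) ((a i)%:R / (sylvester i)%:R) :> F.
  rewrite prodE ler_pdivlMr ?ltr0n ?sylvester_t_gt0 // mul1r.
  have := prod_inv_le_sub_sum_inv a_gt0 sum_lt1.
  move/le_trans/(_ (_ : _ <= (sylvester_t n)%:R^-1)).
  rewrite lerBlDr addrC -lerBlDr => /(_ sum_ge).
  rewrite lef_pV2 ?posrE ?ltr0n ?sylvester_t_gt0 //.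
  by rewrite big_nat; apply: prodr_gt0 => i ltin; rewrite ltr0n a_gt0.
have mean_ge0 : 0 <= (\sum_(i < n) (a i)%:R / (sylvester i)%:R) / n%:R :> F.
  by rewrite divr_ge0 // sumr_ge0.
have mean_le1 : (\sum_(i < n) (a i)%:R / (sylvester i)%:R) / n%:R <= 1 :> F.
  case: (posnP n) => [->|n_gt0]; first by rewrite big_ord0 mul0r.
  by rewrite ler_pdivrMr ?ltr0n // mul1r.
have mean_exp_le1 := exprn_ile1 n mean_ge0 mean_le1.
have prod1 : \prod_(i < n) ((a i)%:R / (sylvester i)%:R) = 1 :> F.
  by apply/le_anti; rewrite prod_ge1 (le_trans prod_le).
(* Equality in AM-GM makes all ratios a_i/y_i equal; being nonnegative with product 1, each of them
   is 1. *)
have : [forall i in 'I_n, forall j in 'I_n,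
    (a i)%:R / (sylvester i)%:R == (a j)%:R / (sylvester j)%:R :> F].
  by rewrite -prod_eq eq_le prod_le prod1.
move=> /forall_inP r_eq i lt_in.
have /forall_inP ri_eq := r_eq (Ordinal lt_in) isT.
suff /divr1_eq/eqP : (a i)%:R / (sylvester i)%:R = 1 :> F.
  by rewrite eqr_nat => /eqP.
apply/eqP; rewrite -(@pexpr_eq1 _ _ n) ?(leq_ltn_trans _ lt_in) ?divr_ge0 //.
rewrite -[eqbRHS]prod1 -[in X in _ ^+ X](card_ord n) -prodr_const.
by apply/eqP; apply: eq_bigr => j _; apply/eqP; exact: ri_eq.
Qed.
End EgyptianFractions.

(** Both 1/k_a and 1/k_b are at most 1/gcd, and the other n unit fractions add up to at most 1 -
    1/t_n; hence 1/t_n <= 2/gcd. Equality makes each of these bounds tight, and [s] then lists the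
    indices in the order of the entries of Q'_d. *)
Lemma gcdn_le_sylvester (F : realFieldType) n (k : 'I_n.+2 -> nat) a b :
    (forall i, (0 < k i)%N) -> \sum_i (k i)%:R^-1 = 1 :> F -> a != b ->
  (gcdn (k a) (k b) <= 2 * sylvester_t n)%N /\
  (gcdn (k a) (k b) = 2 * sylvester_t n ->
   exists s : 'I_n.+2 -> 'I_n.+2, [/\ injective s, s (inord n) = a, s ord_max = b &
     forall i, k (s i) = if (i < n)%N then sylvester i else (2 * sylvester_t n)%N])%N.
Proof.
move=> k_gt0 sum_k neq_ab.
(* Sorting by [k] provides the nondecreasing sequence that [curtiss] expects. *)
pose s := sort (relpre k leq) [seq i <- enum 'I_n.+2 | (i != a) && (i != b)].
pose L := rcons (rcons s a) b.
have uniqL : uniq L.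
  rewrite !rcons_uniq mem_rcons inE !mem_sort !mem_filter !eqxx !andbF orbF.
  by rewrite eq_sym neq_ab sort_uniq filter_uniq // enum_uniq.
have permL : perm_eq L (enum 'I_n.+2).
  apply: uniq_perm => //; first exact: enum_uniq.
  move=> i; rewrite mem_enum !mem_rcons !inE mem_rcons inE mem_sort mem_filter.
  rewrite mem_enum andbT.
  by case: eqVneq => // _; case: eqVneq.
have size_s : size s = n.
  by have := perm_size permL; rewrite !size_rcons size_enum_ord => -[].
have sum_s : \sum_(0 <= i < n) (k (nth a s i))%:R^-1 = 1 - (k a)%:R^-1 - (k b)%:R^-1 :> F.
  have : \sum_(i <- L) (k i)%:R^-1 = 1 :> F by rewrite (perm_big _ permL) big_enum.
  rewrite /L -!cats1 !big_cat !big_seq1 /= (big_nth a) size_s; lra.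
have s_mono i j : (i <= j < n)%N -> (k (nth a s i) <= k (nth a s j))%N.
  move=> /andP[le_ij lt_jn].
  apply: (@sorted_leq_nth _ (relpre k leq));
    rewrite ?inE ?size_s ?(leq_ltn_trans le_ij) //.
  - by move=> x y z /=; apply: leq_trans.
  - by move=> x /=.
  by apply: sort_sorted => x y /=; apply: leq_total.
have ka_gt0 : 0 < (k a)%:R^-1 :> F by rewrite invr_gt0 ltr0n.
have kb_gt0 : 0 < (k b)%:R^-1 :> F by rewrite invr_gt0 ltr0n.
have sum_lt1 : \sum_(0 <= i < n) (k (nth a s i))%:R^-1 < 1 :> F by rewrite sum_s; lra.
have curtiss_s := curtiss s_mono (fun i _ => k_gt0 _) sum_lt1.
(* A larger sum would force the Sylvester fractions through [curtiss], and those add up to exactly 1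
   - 1/t_n. *)
have sum_le : \sum_(0 <= i < n) (k (nth a s i))%:R^-1 <= 1 - (sylvester_t n)%:R^-1 :> F.
  rewrite leNgt; apply/negP => lt_sum; have sE := curtiss_s (ltW lt_sum).
  move: lt_sum; rewrite -sum_inv_sylvester.
  suff -> : \sum_(0 <= i < n) (k (nth a s i))%:R^-1 =
      \sum_(0 <= i < n) (sylvester i)%:R^-1 :> F by rewrite ltxx.
  by apply: eq_big_nat => i /andP[_ /sE->].
set g := gcdn _ _.
have g_gt0 : 0 < g%:R :> F by rewrite ltr0n gcdn_gt0 k_gt0.
have t_gt0 : 0 < (sylvester_t n)%:R :> F by rewrite ltr0n sylvester_t_gt0.
have ka_le : (k a)%:R^-1 <= g%:R^-1 :> F.
  by rewrite lef_pV2 ?posrE // ?ltr0n // ler_nat dvdn_leq // dvdn_gcdl.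
have kb_le : (k b)%:R^-1 <= g%:R^-1 :> F.
  by rewrite lef_pV2 ?posrE // ?ltr0n // ler_nat dvdn_leq // dvdn_gcdr.
split.
  rewrite -(ler_nat F) natrM -(lef_pV2) ?posrE ?mulr_gt0 // invfM.
  move: sum_le; rewrite sum_s; lra.
move=> gE; have gV : g%:R^-1 *+ 2 = (sylvester_t n)%:R^-1 :> F.
  by rewrite gE natrM invfM -mulrnAl -mulr_natr mulVf ?mul1r.
have kaE : k a = g.
  apply/eqP; rewrite -(eqr_nat F) -(inj_eq invr_inj).
  apply/eqP/le_anti; rewrite ka_le /=.
  move: sum_le; rewrite sum_s -gV mulr2n; lra.
have kbE : k b = g.
  apply/eqP; rewrite -(eqr_nat F) -(inj_eq invr_inj).
  apply/eqP/le_anti; rewrite kb_le /=.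
  move: sum_le; rewrite sum_s -gV mulr2n; lra.
have sE : forall i, (i < n)%N -> k (nth a s i) = sylvester i.
  by apply: curtiss_s; rewrite sum_s kaE kbE -gV mulr2n opprD addrA.
have sizeL : size L = n.+2 by rewrite !size_rcons size_s.
have nthL i : nth a L i = if (i < n)%N then nth a s i else if i == n then a else
    if i == n.+1 then b else a.
  by rewrite !nth_rcons size_rcons size_s ltnS leq_eqVlt; case: ltngtP.
exists (fun i => nth a L i); split=> [i j /eqP||| i].
- by rewrite nth_uniq ?sizeL // => /eqP/val_inj.
- by rewrite nthL inordK // ltnn eqxx.
- by rewrite nthL /= ltnNge leqnSn /= eqn_leq ltnn eqxx.
rewrite nthL; case: ifP => [/sE //|/negbT]; rewrite -leqNgt => le_ni.
rewrite -gE; case: eqP => // neq_in.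
suff -> : nat_of_ord i = n.+1 by rewrite eqxx.
by apply/eqP; rewrite eqn_leq -ltnS ltn_ord ltn_neqAle le_ni eq_sym andbT; apply/eqP.
Qed.

(** * Simplices and their duals *)

Section Pairing.
Variables (R : realType) (d : nat).
Implicit Types x y z : 'rV[R]_d.

Lemma pairingC x y : pairing x y = pairing y x.
Proof. by apply: eq_bigr => i _; rewrite mulrC. Qed.

Lemma pairingDr x y z : pairing x (y + z) = pairing x y + pairing x z.
Proof. by rewrite -big_split; apply: eq_bigr => i _; rewrite mxE mulrDr. Qed.

Lemma pairingZr x a y : pairing x (a *: y) = a * pairing x y.
Proof. by rewrite mulr_sumr; apply: eq_bigr => i _; rewrite mxE mulrCA. Qed.

Lemma pairingNr x y : pairing x (- y) = - pairing x y.
Proof. by rewrite -scaleN1r pairingZr mulN1r. Qed.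

Lemma pairingBr x y z : pairing x (y - z) = pairing x y - pairing x z.
Proof. by rewrite pairingDr pairingNr. Qed.

Lemma pairing_sumr (I : Type) (r : seq I) (P : pred I) (F : I -> 'rV[R]_d) x :
  pairing x (\sum_(i <- r | P i) F i) = \sum_(i <- r | P i) pairing x (F i).
Proof.
elim/big_rec2: _ => [|i a b _ <-]; last by rewrite pairingDr.
by apply: big1 => i _; rewrite mxE mulr0.
Qed.

Lemma pairing_mulmx x y : pairing x y = (x *m y^T) 0 0.
Proof. by rewrite mxE; apply: eq_bigr => i _; rewrite mxE. Qed.

Lemma latticeP x : lattice x <-> forall i, x 0 i \is a Num.int.
Proof.
split=> [[m _ <-] i|x_int]; first by rewrite mxE intr_int.
exists (map_mx Num.floor x) => //.
by apply/rowP => i; rewrite !mxE floorK // x_int.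
Qed.

Lemma lattice_pairing x y : lattice x -> lattice y -> pairing x y \is a Num.int.
Proof.
move=> /latticeP x_int /latticeP y_int.
by apply: rpred_sum => i _; rewrite rpredM.
Qed.

Lemma conv_point n (p : 'I_n -> 'rV[R]_d) i : conv p (p i).
Proof.
exists (fun j => (j == i)%:R); split=> [j||].
- by rewrite ler0n.
- by rewrite (bigD1 i) //= eqxx big1 ?addr0 // => j /negPf->.
rewrite (bigD1 i) //= eqxx scale1r big1 ?addr0 // => j /negPf->.
by rewrite scale0r.
Qed.

Lemma conv_sub_affine_hull n (p : 'I_n -> 'rV[R]_d) :
  conv p `<=` affine_hull (range p).
Proof. by move=> x [a [_ sum_a ->]]; exists n, p, a; split=> // i; exists i. Qed.

Lemma pairing_conv_ge n (p : 'I_n -> 'rV[R]_d) c b x :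
  conv p x -> (forall i, b <= pairing c (p i)) -> b <= pairing c x.
Proof.
move=> [a [a_ge0 sum_a ->]] p_ge; rewrite pairing_sumr -[b]mul1r -sum_a mulr_suml.
by apply: ler_sum => i _; rewrite pairingZr ler_wpM2l.
Qed.

(** The slacks b - <c, p_j> are nonnegative and their combination with weights a_j vanishes on the
    face, so a point of nonzero weight has slack 0. *)
Lemma face_conv_point n (p : 'I_n -> 'rV[R]_d) F (a : 'I_n -> R) i :
    face (conv p) F -> (forall j, 0 <= a j) -> \sum_j a j = 1 ->
    F (\sum_j a j *: p j) -> a i != 0 ->
  F (p i).
Proof.
move=> [c [b [le_b ->]]] a_ge0 sum_a [_ /= cb] ai0.
split; first exact: conv_point.
have slack_ge0 j : 0 <= a j * (b - pairing c (p j)).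
  by rewrite mulr_ge0 // subr_ge0; apply/le_b/conv_point.
have : \sum_j a j * (b - pairing c (p j)) == 0.
  apply/eqP; under eq_bigr => j _ do rewrite mulrBr -pairingZr.
  by rewrite sumrB -mulr_suml sum_a mul1r -pairing_sumr cb subrr.
rewrite psumr_eq0 // => /allP/(_ i (mem_index_enum _)) /=.
by rewrite mulf_eq0 (negPf ai0) /= subr_eq0 => /eqP->.
Qed.

Lemma face_nonempty_point n (p : 'I_n -> 'rV[R]_d) F x :
  face (conv p) F -> F x -> exists i, F (p i).
Proof.
move=> faceF Fx; have [a [a_ge0 sum_a xE]] : conv p x.
  by move: faceF Fx => [c [b [_ ->]]] [].
have [i ai0] : exists i, a i != 0.
  apply/existsP; rewrite -negb_forall; apply/negP => /forallP a0.
  by move/eqP: sum_a; rewrite big1 1?eq_sym ?oner_eq0 // => i _; apply/eqP.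
by exists i; apply: face_conv_point faceF a_ge0 sum_a _ ai0; rewrite -xE.
Qed.

Lemma vertex_conv n (p : 'I_n -> 'rV[R]_d) w :
  vertex (conv p) w -> exists i, w = p i.
Proof. by move=> faceF; have [i <-] := face_nonempty_point faceF erefl; exists i. Qed.

Lemma conv_perm n (p : 'I_n -> 'rV[R]_d) (s : 'I_n -> 'I_n) :
  injective s -> conv (p \o s) = conv p.
Proof.
move=> s_inj; apply/seteqP; split=> x [a [a_ge0 sum_a ->]].
  exists (a \o invF s_inj); split=> [i||] //=.
    by rewrite (reindex_inj s_inj) /=; under eq_bigr do rewrite invF_f.
  by rewrite [RHS](reindex_inj s_inj) /=; apply: eq_bigr => i _; rewrite invF_f.
exists (a \o s); split=> [i||] //=; first by rewrite -[RHS]sum_a [RHS](reindex_inj s_inj).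
by rewrite (reindex_inj s_inj).
Qed.

End Pairing.

(* [v] and [eta] are the vertices of a simplex and of its dual, and [(k i)^-1]
   are the barycentric coordinates of the origin.  The two are exchangeable. *)
Definition polar_pair (R : realType) (d : nat) (v eta : 'I_d.+1 -> 'rV[R]_d)
    (k : 'I_d.+1 -> R) : Prop :=
  [/\ forall i, 0 < k i, \sum_i (k i)^-1 = 1
    & forall i j, pairing (eta i) (v j) = k i *+ (i == j) - 1].

Section PolarPair.
Variables (R : realType) (d : nat).
Implicit Types v eta : 'I_d.+1 -> 'rV[R]_d.

Lemma polar_pairC v eta k : polar_pair v eta k -> polar_pair eta v k.
Proof.
move=> [k_gt0 sum_k vE]; split=> // i j.
by rewrite pairingC vE eq_sym; case: eqP => // ->.
Qed.

Lemma polar_pair_perm v eta k (s : 'I_d.+1 -> 'I_d.+1) : injective s ->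
  polar_pair v eta k -> polar_pair (v \o s) (eta \o s) (k \o s).
Proof.
move=> s_inj [k_gt0 sum_k vE]; split=> [i||i j] //=.
  by rewrite -[RHS]sum_k [RHS](reindex_inj s_inj).
by rewrite vE inj_eq.
Qed.

Variables (v eta : 'I_d.+1 -> 'rV[R]_d) (k : 'I_d.+1 -> R).
Hypothesis vP : polar_pair v eta k.

(** Pairing with eta_i isolates the i-th coefficient; for an affine combination x it recovers the
    barycentric coordinate as (<eta_i, x> + 1)/k_i. *)
Lemma polar_pair_comb (a : 'I_d.+1 -> R) i :
  pairing (eta i) (\sum_j a j *: v j) = k i * a i - \sum_j a j.
Proof.
have [_ _ vE] := vP; rewrite pairing_sumr.
under eq_bigr => j _ do rewrite pairingZr vE mulrBr mulr1.
rewrite sumrB; congr (_ - _); rewrite (bigD1 i) //= eqxx big1 ?addr0.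
  by rewrite mulrC.
by move=> j; rewrite eq_sym => /negPf->; rewrite mulr0.
Qed.

Lemma polar_pair_affinely_independent : affinely_independent v.
Proof.
have [k_gt0 _ _] := vP; move=> a sum_a comb_a i; have := polar_pair_comb a i.
rewrite sum_a comb_a subr0 -(scale0r 0) pairingZr mul0r => /esym/eqP.
by rewrite mulf_eq0 gt_eqF //= => /eqP.
Qed.

(* The pairing matrix diag(k) - J has rank at least d. *)
Lemma polar_pair_separating x : (forall i, pairing (v i) x = 0) -> x = 0.
Proof.
move=> vx0; have [k_gt0 _ vE] := vP.
pose A := \matrix_i v i; pose B := \matrix_i eta i.
pose J : 'M[R]_d.+1 := const_mx 1.
have BA : B *m A^T = diag_mx (\row_i k i) - J.
  apply/matrixP => i j; rewrite !mxE -vE.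
  by apply: eq_bigr => l _; rewrite !mxE.
have rank_diag : \rank (diag_mx (\row_i k i)) = d.+1.
  apply: mxrank_unit; rewrite unitmxE det_diag unitfE prodf_seq_neq0.
  by apply/allP => i _; rewrite mxE gt_eqF.
have rank_J : (\rank J <= 1)%N.
  have -> : J = (const_mx 1 : 'cV[R]_d.+1) *m (const_mx 1 : 'rV[R]_d.+1).
    by apply/matrixP => i j; rewrite !mxE big_ord1 !mxE mulr1.
  by apply: leq_trans (mxrankM_maxl _ _) (rank_leq_col _).
(* Since diag(k) = B A^T + J with J of rank at most 1, the rows v_i span the whole space, and [A]
   has a left inverse. *)
have : (d.+1 <= \rank A + 1)%N.
  rewrite -[X in (X <= _)%N]rank_diag -(subrK J (diag_mx _)) -BA.
  apply: leq_trans (mxrank_add _ _) (leq_add _ rank_J).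
  by rewrite -(mxrank_tr A); apply: mxrankM_maxr.
rewrite addn1 ltnS => rankA.
have fullA : row_full A by rewrite /row_full eqn_leq rank_leq_col.
have [B' B'A] := row_fullP fullA.
apply: trmx_inj; rewrite trmx0 -[x^T]mul1mx -B'A -mulmxA.
suff -> : A *m x^T = 0 by rewrite mulmx0.
apply/colP => i; rewrite [RHS]mxE -(vx0 i) mxE.
by apply: eq_bigr => l _; rewrite !mxE.
Qed.
End PolarPair.

(** Each eta_i pairs with this combination to k_i/k_i - 1 = 0, and the eta_i separate points. *)
Lemma polar_pair_origin (R : realType) d (v eta : 'I_d.+1 -> 'rV[R]_d) k :
  polar_pair v eta k -> \sum_j (k j)^-1 *: v j = 0.
Proof.
move=> vP; have [k_gt0 sum_k _] := vP.
apply: (polar_pair_separating (polar_pairC vP)) => i.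
by rewrite (polar_pair_comb vP) sum_k divff ?gt_eqF ?subrr.
Qed.

(** * Facets, faces and edges of a simplex *)

Definition segment (R : realType) (d : nat) (p q : 'rV[R]_d) : set 'rV[R]_d :=
  [set p + s *: (q - p) | s in [set s : R | 0 <= s <= 1]].

Section SimplexFaces.
Variables (R : realType) (d : nat) (v eta : 'I_d.+1 -> 'rV[R]_d) (k : 'I_d.+1 -> R).
Hypothesis vP : polar_pair v eta k.

Lemma polar_pair_inj x y :
  (forall i, pairing (eta i) x = pairing (eta i) y) -> x = y.
Proof.
move=> xy; apply/eqP; rewrite -subr_eq0; apply/eqP.
apply: (polar_pair_separating (polar_pairC vP)) => i.
by rewrite pairingBr xy subrr.
Qed.

(** By [polar_pair_comb], the facet inequalities say that the barycentric coordinates are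
    nonnegative. *)
Lemma polar_pair_convP x : conv v x <-> forall i, -1 <= pairing (eta i) x.
Proof.
have [k_gt0 sum_k vE] := vP; split=> [vx i|x_ge].
  apply: pairing_conv_ge vx _ => j; rewrite vE lerDr mulrn_wge0 //.
  exact: ltW.
have sum_eta := polar_pair_origin (polar_pairC vP).
pose a j := (pairing (eta j) x + 1) / k j.
(* The weights 1/k_j annihilate the eta_j, so only \sum 1/k_j = 1 survives. *)
have sum_a : \sum_j a j = 1.
  under eq_bigr do rewrite /a mulrDl mul1r.
  rewrite big_split /= sum_k; under eq_bigr do rewrite pairingC mulrC -pairingZr.
  by rewrite -pairing_sumr sum_eta -(scale0r 0) pairingZr mul0r add0r.
exists a; split=> // [i|].
  by apply: divr_ge0 (ltW (k_gt0 i)); rewrite -lerBlDr sub0r.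
apply: polar_pair_inj => // i.
by rewrite (polar_pair_comb vP) sum_a mulrC divfK ?gt_eqF // addrK.
Qed.

(** Minus the sum of the eta_i with i outside [I] reaches its bound [#|~: I|] exactly where all the
    slacks <eta_i, x> + 1 with i outside [I] vanish. *)
Lemma face_opposite (I : {set 'I_d.+1}) :
  face (conv v) (conv v `&` [set x | forall i, i \notin I -> pairing (eta i) x = -1]).
Proof.
pose c : 'rV[R]_d := - \sum_(i in ~: I) eta i.
have cE x : pairing c x = #|~: I|%:R - \sum_(i in ~: I) (pairing (eta i) x + 1).
  rewrite big_split /= sumr_const opprD addrCA subrr addr0.
  by rewrite pairingC pairingNr pairing_sumr; under eq_bigr do rewrite pairingC.
have slack_ge0 x : conv v x -> forall i, i \in ~: I -> 0 <= pairing (eta i) x + 1.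
  by move=> /polar_pair_convP x_ge i _; rewrite -lerBlDr sub0r.
exists c, #|~: I|%:R; split=> [x vx|].
  by rewrite cE gerBl sumr_ge0 //; apply: slack_ge0.
apply/seteqP; split=> x [vx xI]; split=> //=.
  rewrite cE big1 ?subr0 // => i; rewrite finset.in_setC => /xI->.
  by rewrite addNr.
move=> i iI; move: xI => /= /eqP; rewrite cE subr_eq addrC -subr_eq subrr eq_sym.
rewrite psumr_eq0; last exact: slack_ge0.
move=> /allP/(_ i (mem_index_enum _))/implyP; rewrite finset.in_setC iI => /(_ isT).
by rewrite addr_eq0 => /eqP.
Qed.

(** <eta_i, x> = -1 means that the i-th barycentric coordinate is 0, so the combination is supported
    on [I]. *)
Lemma conv_opposite (I : {set 'I_d.+1}) x :
    conv v x -> (forall i, i \notin I -> pairing (eta i) x = -1) ->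
  exists2 a : 'I_d.+1 -> R, forall i, 0 <= a i &
    \sum_(i in I) a i = 1 /\ x = \sum_(i in I) a i *: v i.
Proof.
have [k_gt0 _ _] := vP; move=> [a [a_ge0 sum_a ->]] aI; exists a => //.
have a0 i : i \notin I -> a i = 0.
  move=> /aI; rewrite (polar_pair_comb vP) sum_a => /eqP.
  by rewrite -subr_eq0 opprK subrK mulf_eq0 gt_eqF //= => /eqP.
split.
  rewrite -sum_a [RHS](bigID [in I]) /= [X in _ + X]big1 ?addr0 //.
by rewrite [LHS](bigID [in I]) /= [X in _ + X]big1 ?addr0 // => i /a0->; rewrite scale0r.
Qed.

Lemma conv_vertex i : vertex (conv v) (v i).
Proof.
have [_ _ vE] := vP; rewrite /vertex.
suff -> : [set v i] =
    conv v `&` [set x | forall j, j \notin [set i]%SET -> pairing (eta j) x = -1].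
  exact: face_opposite.
apply/seteqP; split=> [x ->|x [vx /(conv_opposite vx)[a _]]].
  split=> [|j]; first exact: conv_point.
  by rewrite inE => /negPf ji; rewrite vE ji sub0r.
by rewrite !big_set1 => -[-> ->]; rewrite scale1r.
Qed.

Lemma polar_pair_neq a b : a != b -> v a != v b.
Proof.
move=> neq_ab; apply/eqP => vab; have [k_gt0 _ vE] := vP.
have := vE a b; rewrite -vab vE eqxx (negPf neq_ab) => /addIr/eqP.
by rewrite mulr1n mulr0n gt_eqF.
Qed.

Lemma conv_segment_edge a b : a != b -> edge (conv v) (segment (v a) (v b)).
Proof.
move=> neq_ab; have [k_gt0 _ vE] := vP.
have vab0 : v b - v a != 0 by rewrite subr_eq0 eq_sym polar_pair_neq.
split.
  suff -> : segment (v a) (v b) = conv v `&`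
      [set x | forall j, j \notin [set a; b]%SET -> pairing (eta j) x = -1].
    exact: face_opposite.
  apply/seteqP; split=> [_ [s /andP[s_ge0 s_le1] <-]|x [vx /(conv_opposite vx)[c c_ge0]]].
    have etaE j : pairing (eta j) (v a + s *: (v b - v a)) =
        (1 - s) * (k j *+ (j == a)) + s * (k j *+ (j == b)) - 1.
      rewrite pairingDr pairingZr pairingBr !vE; ring.
    split=> [|j]; last first.
      by rewrite !inE negb_or etaE => /andP[/negPf-> /negPf->]; rewrite !mulr0 addr0 sub0r.
    apply/polar_pair_convP => j; rewrite etaE lerDr addr_ge0 //.
      by rewrite mulr_ge0 ?subr_ge0 // mulrn_wge0 // ltW.
    by rewrite mulr_ge0 // mulrn_wge0 // ltW.
  rewrite !big_setU1 ?big_set1 ?inE //= => -[cab ->]; exists (c b).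
    by rewrite /= c_ge0 -cab lerDr c_ge0.
  have -> : c a = 1 - c b by rewrite -cab addrK.
  by rewrite scalerBr scalerBl scale1r addrCA addrC.
pose p (i : 'I_2) := if i == 0 then v a else v b.
exists p; split=> [c|i|_ [s _ <-]].
- rewrite !big_ord_recl !big_ord0 /= !addr0 /p /= => /eqP.
  set c0 := c ord0; set c1 := c (lift ord0 ord0).
  rewrite addr_eq0 => /eqP c01; rewrite c01 => /eqP.
  rewrite scaleNr addrC -scalerBr scaler_eq0.
  rewrite (negPf vab0) orbF => /eqP c10 i.
  case: (unliftP ord0 i) => [j ->|->]; last by rewrite -/c0 c01 c10 oppr0.
  by rewrite (ord1 j).
- rewrite /p; case: ifP => _; [exists 0|exists 1] => //=; rewrite ?lexx ?ler01 //.
    by rewrite scale0r addr0.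
  by rewrite scale1r addrC subrK.
exists 2%N, p, (fun i : 'I_2 => if i == 0 then 1 - s else s); split=> [i||].
- by exists i.
- by rewrite !big_ord_recl big_ord0 /= addr0 subrK.
by rewrite !big_ord_recl big_ord0 /= addr0 /p /= scalerBl scale1r scalerBr addrA addrAC.
Qed.

(** A face contains every vertex that carries nonzero weight in one of its points. Two distinct
    points of [E] yield two vertices, and dimension one excludes a third, since no three vertices of
    a simplex are collinear. *)
Lemma edge_conv_segment E : edge (conv v) E ->
  exists a b, a != b /\ E = segment (v a) (v b).
Proof.
have [k_gt0 _ vE] := vP; move=> [faceE [p [p_indep Ep E_aff]]].
have line : exists w, forall x, E x -> exists s : R, x = p ord0 + s *: w.
  exists (p (lift ord0 ord0) - p ord0) => x /E_aff[n [q [c [pq sum_c ->]]]].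
  have qE i : exists s : R, q i = p ord0 + s *: (p (lift ord0 ord0) - p ord0).
    have [j _ <-] := pq i; case: (unliftP ord0 j) => [j' ->|->].
      by exists 1; rewrite (ord1 j') scale1r addrC subrK.
    by exists 0; rewrite scale0r addr0.
  have [s sE] := choice qE; exists (\sum_i c i * s i).
  under eq_bigr do rewrite sE scalerDr scalerA.
  by rewrite big_split /= -!scaler_suml sum_c scale1r.
have p_neq : p ord0 <> p (lift ord0 ord0).
  move=> p_eq; pose c (i : 'I_2) : R := if i == 0 then 1 else -1.
  suff /(_ ord0)/eqP : forall i, c i = 0 by rewrite /c /= oner_eq0.
  apply: p_indep; rewrite !big_ord_recl big_ord0 /c /= addr0 ?subrr //.
  by rewrite scale1r scaleN1r p_eq subrr.
have sub_conv x : E x -> conv v x by move: faceE => [c [b [_ ->]]] [].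
have [a Ea] := face_nonempty_point faceE (Ep ord0).
have [b neq_ab Eb] : exists2 b, a != b & E (v b).
  apply: contrapT => nob; apply: p_neq.
  suff Ea_only x : E x -> x = v a by rewrite (Ea_only _ (Ep ord0)) (Ea_only _ (Ep _)).
  move=> Ex; have [c [c_ge0 sum_c xE]] := sub_conv x Ex.
  have c0 j : j != a -> c j = 0.
    rewrite eq_sym => neq_aj; apply/eqP; apply: contra_notT nob => cj0; exists j => //.
    by apply: face_conv_point faceE c_ge0 sum_c _ cj0; rewrite -xE.
  rewrite xE (bigD1 a) //= big1 => [|j /c0->]; last by rewrite scale0r.
  move: sum_c; rewrite (bigD1 a) //= big1 //; rewrite !addr0 => ->.
  by rewrite scale1r.
(* The functional eta_a takes the same value at v_b and v_c, so it is constant on a line through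
   both; yet its value at v_a is larger by k_a. *)
have E_only c : E (v c) -> c \in [set a; b]%SET.
  move=> Ec; apply/negPn/negP; rewrite !inE negb_or => /andP[neq_ca neq_cb].
  have [w wE] := line.
  have [[sa saE] [[sb sbE] [sc scE]]] := (wE _ Ea, (wE _ Eb, wE _ Ec)).
  have pair_diff i j l si sj : v i = p ord0 + si *: w -> v j = p ord0 + sj *: w ->
      (si - sj) * pairing (eta l) w = k l *+ (l == i) - k l *+ (l == j).
    move=> viE vjE.
    have := vE l i; rewrite viE pairingDr pairingZr => E1.
    have := vE l j; rewrite vjE pairingDr pairingZr => E2.
    lra.
  have := pair_diff _ _ a _ _ saE scE;
  rewrite eqxx eq_sym (negPf neq_ca) subr0 mulr1n => wa.
  have := pair_diff _ _ a _ _ sbE scE;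
  rewrite (negPf neq_ab) eq_sym (negPf neq_ca) subr0 => /eqP.
  rewrite mulf_eq0 subr_eq0 => /orP[/eqP sbc|/eqP w0].
    by move: (polar_pair_neq neq_cb); rewrite sbE scE sbc eqxx.
  by move: (k_gt0 a); rewrite -wa w0 mulr0 ltxx.
exists a, b; split=> //; apply/seteqP; split=> x.
  move=> Ex; have [c [c_ge0 sum_c xE]] := sub_conv x Ex.
  have c0 j : j \notin [set a; b]%SET -> c j = 0.
    move=> jab; apply/eqP; apply: contraNT jab => cj0; apply: E_only.
    by apply: face_conv_point faceE c_ge0 sum_c _ cj0; rewrite -xE.
  move: sum_c xE; rewrite (bigID [in [set a; b]%SET]) /= [X in _ + X]big1 ?addr0 //.
  rewrite [X in x = X -> _](bigID [in [set a; b]%SET]) /=.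
  rewrite [X in _ = _ + X -> _]big1 ?addr0; last first.
    by move=> j /c0->; rewrite scale0r.
  rewrite !big_setU1 ?big_set1 ?inE //= => cab ->; exists (c b).
    by rewrite /= c_ge0 -cab lerDr c_ge0.
  have -> : c a = 1 - c b by rewrite -cab addrK.
  by rewrite scalerBr scalerBl scale1r addrCA addrC.
case=> s /andP[s_ge0 s_le1] <-.
move: faceE Ea Eb => [c [m [le_m ->]]] [va ca] [vb cb].
split=> /=; last by rewrite pairingDr pairingZr pairingBr ca cb subrr mulr0 addr0.
apply/polar_pair_convP => i; move: va vb.
move=> /polar_pair_convP/(_ i) ? /polar_pair_convP/(_ i) ?.
rewrite pairingDr pairingZr pairingBr; nra.
Qed.
End SimplexFaces.

(** * Reflexive simplices as polar pairs of lattice points *)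

Section Reflexive.
Variables (R : realType) (d : nat).
Implicit Types v eta : 'I_d.+1 -> 'rV[R]_d.

Lemma polar_pair_dual v eta k : polar_pair v eta k -> dual (conv v) = conv eta.
Proof.
move=> /polar_pairC etaP; apply/seteqP; split=> x.
  move=> x_ge; apply/(polar_pair_convP etaP) => i.
  exact/x_ge/conv_point.
move=> /(polar_pair_convP etaP) x_ge y vy; rewrite pairingC.
by apply: pairing_conv_ge vy _ => i; rewrite pairingC.
Qed.

Lemma pairing_continuous (c : 'rV[R]_d) : continuous (pairing c).
Proof.
move=> x; rewrite /pairing.
suff cont (s : seq 'I_d) :
    {for x, continuous (fun y : 'rV[R]_d => \sum_(i <- s) c 0 i * y 0 i)}.
  exact: cont.
elim: s => [|i s IHs].
  have -> : (fun y : 'rV[R]_d => \sum_(i <- [::]) c 0 i * y 0 i) = cst 0.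
    by apply/funext => y; rewrite big_nil.
  exact: cst_continuous.
have -> : (fun y : 'rV[R]_d => \sum_(j <- i :: s) c 0 j * y 0 j) =
    (fun y : 'rV[R]_d => c 0 i * y 0 i + \sum_(j <- s) c 0 j * y 0 j).
  by apply/funext => y; rewrite big_cons.
apply: continuousD IHs; apply: continuousM; first exact: cst_continuous.
exact: coord_continuous.
Qed.

Lemma polar_pair_reflexive_simplex v eta k :
    polar_pair v eta k -> (forall i, lattice (v i)) -> (forall i, lattice (eta i)) ->
  reflexive_simplex (conv v).
Proof.
move=> vP v_lat eta_lat; split; last first.
  by exists d, v; split=> //; apply: polar_pair_affinely_independent vP.
split.
- by split=> [|w /vertex_conv[i ->]] //; exists d.+1, v.
- exists v; split=> [|i|]; first exact: polar_pair_affinely_independent vP.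
    exact: conv_point.
  exact: conv_sub_affine_hull.
(* The finitely many facet inequalities are strict at the origin, hence by continuity on a
   neighbourhood of it. *)
- have : \forall x \near (0 : 'rV[R]_d), forall i, -1 < pairing (eta i) x.
    apply: (@filter_forall _ _ _ (nbhs (0 : 'rV[R]_d)) (nbhs_filter _)) => i.
    apply: (cvgr_gt _ (@pairing_continuous (eta i) 0)).
    by rewrite -(scale0r 0) pairingZr mul0r oppr_lt0 ltr01.
  rewrite /interior /=; apply: filterS => x x_gt.
  by apply/(polar_pair_convP vP) => i; apply: ltW.
rewrite (polar_pair_dual vP); split=> [|w /vertex_conv[i ->]] //.
by exists d.+1, eta.
Qed.

(** Prefixing a coordinate 1 turns affine independence into linear independence. *)
Lemma affinely_independent_row_free n (p : 'I_n -> 'rV[R]_d) :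
  affinely_independent p ->
  row_free (row_mx (const_mx 1 : 'cV[R]_n) (\matrix_i p i)).
Proof.
move=> p_indep; apply: inj_row_free => a; rewrite mul_mx_row => /eqP.
rewrite row_mx_eq0 => /andP[/eqP a1 /eqP ap]; apply/rowP => i; rewrite mxE.
apply: (p_indep (a 0)).
  transitivity ((a *m (const_mx 1 : 'cV[R]_n)) 0 0); last by rewrite a1 mxE.
  by rewrite mxE; apply: eq_bigr => j _; rewrite mxE mulr1.
rewrite -[RHS]ap mulmx_sum_row; apply: eq_bigr => j _.
by rewrite rowK.
Qed.

(** The homogenised rows of [q] are combinations of those of [p], so their rank m is at most n. *)
Lemma affinely_independent_conv_leq m n (q : 'I_m -> 'rV[R]_d) (p : 'I_n -> 'rV[R]_d) :
  affinely_independent q -> (forall i, conv p (q i)) -> (m <= n)%N.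
Proof.
move=> /affinely_independent_row_free; rewrite /row_free => /eqP rank_q q_conv.
rewrite -[X in (X <= _)%N]rank_q.
have [a aP] := choice q_conv.
pose A := \matrix_(i, j) a i j.
suff -> : row_mx (const_mx 1 : 'cV[R]_m) (\matrix_i q i) =
    A *m row_mx (const_mx 1 : 'cV[R]_n) (\matrix_i p i).
  by apply: leq_trans (mxrankM_maxr _ _) (rank_leq_row _).
rewrite mul_mx_row; congr row_mx.
  apply/colP => i; rewrite !mxE; have [_ sum_a _] := aP i; rewrite -[LHS]sum_a.
  by apply: eq_bigr => j _; rewrite !mxE mulr1.
apply/row_matrixP => i; rewrite rowK row_mul mulmx_sum_row; have [_ _ ->] := aP i.
by apply: eq_bigr => j _; rewrite rowK !mxE.
Qed.

(** For small e > 0 the point -e p_i stays in the hull. Adding weight e at p_i to its coordinates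
    represents the origin with total weight 1 + e, so uniqueness gives (1 + e) a_i >= e. *)
Lemma conv_interior0_coord n (p : 'I_n -> 'rV[R]_d) :
    affinely_independent p -> interior (conv p) 0 ->
  exists2 a : 'I_n -> R, forall i, 0 < a i &
    \sum_i a i = 1 /\ \sum_i a i *: p i = 0.
Proof.
move=> p_indep int0; have [a [a_ge0 sum_a a_comb]] := nbhs_singleton int0.
exists a => // i.
have [e e_gt0 conv_e] : exists2 e : R, 0 < e & conv p (- e *: p i).
  have [e /= e_gt0 eP] := (@nbhs_normP _ _ (0 : 'rV[R]_d) _).1 int0.
  (* The added 1 keeps the witness positive when p_i = 0 and makes the norm strictly less than
     [e]. *)
  exists (e / (`|p i| + 1)); first by rewrite divr_gt0 // ltr_wpDl.
  apply: eP; rewrite /ball_ /= sub0r scaleNr opprK normrZ ger0_norm; last first.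
    by rewrite divr_ge0 ?(ltW e_gt0) // addr_ge0.
  by rewrite mulrAC ltr_pdivrMr ?ltr_wpDl // ltr_pM2l // ltrDl.
have [b [b_ge0 sum_b b_comb]] := conv_e.
have := p_indep (fun j => b j + e * (j == i)%:R - (1 + e) * a j) _ _ i.
rewrite eqxx mulr1 => /(_ _ _)/eqP; rewrite subr_eq0 => H.
have sum_delta : \sum_j (j == i)%:R = 1 :> R.
  by rewrite (bigD1 i) //= eqxx big1 ?addr0 // => j /negPf->.
have comb_delta : \sum_j (j == i)%:R *: p j = p i.
  by rewrite (bigD1 i) //= eqxx scale1r big1 ?addr0 // => j /negPf->; rewrite scale0r.
have /eqP E : b i + e == (1 + e) * a i.
  apply: H.
    by rewrite sumrB big_split /= -!mulr_sumr sum_b sum_a sum_delta; ring.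
  under eq_bigr do rewrite scalerBl scalerDl -!scalerA.
  rewrite sumrB big_split /= -!scaler_sumr -b_comb -a_comb comb_delta.
  by rewrite scaler0 subr0 scaleNr addNr.
have : 0 < (1 + e) * a i by rewrite -E ltr_wpDl.
by rewrite pmulr_rgt0 // addr_gt0.
Qed.

(** Column j of the inverse of the homogenised matrix is the affine function with value 1 at v_j and
    0 at the other vertices. Its constant term is its value a_j at the origin, and its linear part
    divided by a_j is eta_j. *)
Lemma affinely_independent_polar_pair v (a : 'I_d.+1 -> R) :
    affinely_independent v -> (forall i, 0 < a i) ->
    \sum_i a i = 1 -> \sum_i a i *: v i = 0 ->
  exists eta, polar_pair v eta (fun i => (a i)^-1).
Proof.
move=> v_indep a_gt0 sum_a a_comb.
pose H : 'M[R]_(d.+1, 1 + d) := row_mx (const_mx 1 : 'cV[R]_d.+1) (\matrix_i v i).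
have unitH : (H : 'M[R]_d.+1) \in unitmx.
  by rewrite -row_free_unit; apply: affinely_independent_row_free.
pose G : 'M[R]_(1 + d, d.+1) := invmx (H : 'M[R]_d.+1).
have HG i j : G 0 j + pairing (v i) (\row_l G (rshift 1 l) j) = (i == j)%:R.
  have := congr1 (fun M : 'M[R]_d.+1 => M i j) (mulmxV unitH).
  rewrite [RHS]mxE => <-; rewrite mxE [RHS](@big_split_ord _ _ _ 1 d) /= big_ord1.
  have Hl : H i (lshift d ord0) = 1 by rewrite /H row_mxEl mxE.
  have Hr l : H i (rshift 1 l) = v i 0 l by rewrite /H row_mxEr mxE.
  rewrite Hl mul1r; congr (G _ _ + _); first exact: val_inj.
  by apply: eq_bigr => l _; rewrite Hr mxE.
have G0 j : G 0 j = a j.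
  transitivity (\sum_i a i * (i == j)%:R).
    under eq_bigr do rewrite -HG mulrDr pairingC -pairingZr.
    rewrite big_split /= -mulr_suml sum_a mul1r -pairing_sumr a_comb.
    by rewrite -(scale0r 0) pairingZr mul0r addr0.
  by rewrite (bigD1 j) //= eqxx mulr1 big1 ?addr0 // => i /negPf->; rewrite mulr0.
exists (fun i => (a i)^-1 *: \row_l G (rshift 1 l) i); split=> [i||i j].
- by rewrite invr_gt0.
- by rewrite -[RHS]sum_a; apply: eq_bigr => i _; rewrite invrK.
rewrite pairingC pairingZr; have /(canRL (addKr _)) -> := HG j i.
rewrite G0 mulrDr mulrN mulVf; last by rewrite gt_eqF.
by rewrite addrC eq_sym mulr_natr.
Qed.

(** The eta_i are vertices of the dual, hence lattice points, so k_i = <eta_i, v_i> + 1 is a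
    positive integer. *)
Lemma reflexive_simplex_polar_pair (P : set 'rV[R]_d) : reflexive_simplex P ->
  exists v eta (k : 'I_d.+1 -> nat), [/\ polar_pair v eta (fun i => (k i)%:R),
    forall i, lattice (v i), forall i, lattice (eta i) & P = conv v].
Proof.
move=> [[[_ v_lat] [q [q_indep q_in _]] int0 [_ eta_lat]] [n [v [v_indep PE]]]].
have [a a_gt0 [sum_a a_comb]] : exists2 a : 'I_n.+1 -> R, forall i, 0 < a i &
    \sum_i a i = 1 /\ \sum_i a i *: v i = 0.
  by apply: conv_interior0_coord; rewrite // -PE.
(* n <= d because n + 1 affinely independent points lie in dimension d; d <= n because [has_dim]
   provides d + 1 such points inside [P]. *)
have nd : n = d.
  apply/eqP; rewrite eqn_leq; apply/andP; split; rewrite -ltnS.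
    have := affinely_independent_row_free v_indep.
    by rewrite /row_free => /eqP <-; apply: rank_leq_col.
  by apply: (affinely_independent_conv_leq (p := v) q_indep) => i; rewrite -PE.
subst n P.
have [eta vP] := affinely_independent_polar_pair v_indep a_gt0 sum_a a_comb.
have v_latt i : lattice (v i) by apply: v_lat; apply: conv_vertex vP _.
have eta_latt i : lattice (eta i).
  by apply: eta_lat; rewrite (polar_pair_dual vP); apply: conv_vertex (polar_pairC vP) _.
have k_nat i : (a i)^-1 \is a Num.nat.
  have [k_gt0 _ vE] := vP; rewrite natrEint ltW // andbT.
  rewrite -[_^-1](subrK 1) rpredD ?rpred1 //.
  by have := lattice_pairing (eta_latt i) (v_latt i); rewrite vE eqxx.
have kP i : exists n : nat, (a i)^-1 = n%:R by apply/natrP.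
have [k kE] := choice kP; exists v, eta, k; split=> //.
by have -> : (fun i => (k i)%:R) = (fun i => (a i)^-1) by apply/funext => i.
Qed.

End Reflexive.

(** * Lattice points on edges *)

Section LatticePoints.
Variables (R : realType) (d : nat).
Implicit Types x y : 'rV[R]_d.

Lemma latticeD x y : lattice x -> lattice y -> lattice (x + y).
Proof. by move=> /latticeP xP /latticeP yP; apply/latticeP => i; rewrite mxE rpredD. Qed.

Lemma latticeN x : lattice x -> lattice (- x).
Proof. by move=> /latticeP xP; apply/latticeP => i; rewrite mxE rpredN. Qed.

Lemma latticeMn x n : lattice x -> lattice (n%:R *: x).
Proof. by move=> /latticeP xP; apply/latticeP => i; rewrite mxE rpredM // rpred_nat. Qed.

Variables (v eta : 'I_d.+1 -> 'rV[R]_d) (k : 'I_d.+1 -> nat) (a b : 'I_d.+1).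
Hypotheses (vP : polar_pair v eta (fun i => (k i)%:R)).
Hypotheses (v_lat : forall i, lattice (v i)) (eta_lat : forall i, lattice (eta i)).
Hypothesis neq_ab : a != b.

Let g := gcdn (k a) (k b).
Let point (j : nat) : 'rV[R]_d := v a + (j%:R / g%:R) *: (v b - v a).

Let g_gt0 : 0 < g%:R :> R.
Proof. by have [k_gt0 _ _] := vP; rewrite ltr0n gcdn_gt0 -(ltr0n R) k_gt0. Qed.

(** For a lattice point at parameter s, the pairings with eta_b and eta_a make s k_b and s k_a
    integers; by Bezout, s times the gcd is an integer. *)
Lemma segment_lattice_sub : segment (v a) (v b) `&` @lattice R d `<=`
  point @` (`I_g.+1 `&` [set j | lattice (point j)]).
Proof.
have [k_gt0 _ vE] := vP; move=> _ [[s /andP[s_ge0 s_le1] <-] x_lat].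
have sb : s * (k b)%:R \is a Num.int.
  have := lattice_pairing (eta_lat b) x_lat.
  rewrite pairingDr pairingZr pairingBr !vE eqxx eq_sym (negPf neq_ab) mulr0n mulr1n => H.
  have -> : s * (k b)%:R = 0 - 1 + s * ((k b)%:R - 1 - (0 - 1)) + 1 by ring.
  by rewrite rpredD ?rpred1.
have sa : s * (k a)%:R \is a Num.int.
  have := lattice_pairing (eta_lat a) x_lat.
  rewrite pairingDr pairingZr pairingBr !vE eqxx (negPf neq_ab) mulr0n mulr1n => H.
  have -> : s * (k a)%:R = (k a)%:R - 1 - ((k a)%:R - 1 + s * (0 - 1 - ((k a)%:R - 1))).
    ring.
  by rewrite rpredB // rpredB ?rpred_nat ?rpred1.
have sg : s * g%:R \is a Num.int.
  have ka_gt0 : (0 < k a)%N by rewrite -(ltr0n R) k_gt0.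
  have [u w uw _] := egcdnP (k b) ka_gt0.
  have -> : s * g%:R = (s * (k a)%:R) * u%:R - (s * (k b)%:R) * w%:R.
    have -> : g%:R = (k a)%:R * u%:R - (k b)%:R * w%:R :> R.
      by rewrite -!natrM ![(k _ * _)%N]mulnC uw natrD addrAC subrr add0r.
    by rewrite mulrBr !mulrA.
  by rewrite rpredB // rpredM // rpred_nat.
have /natrP[j jE] : s * g%:R \is a Num.nat.
  by rewrite natrEint sg mulr_ge0 // ltW.
have sE : s = j%:R / g%:R by rewrite -jE mulfK // gt_eqF.
exists j; last by rewrite /point -sE.
split=> /=; last by rewrite /point -sE.
by rewrite ltnS -(ler_nat R) -jE ler_piMl // ltW.
Qed.

Lemma segment_lattice_card_le : segment (v a) (v b) `&` @lattice R d #<= `I_g.+1.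
Proof.
apply: card_le_trans (subset_card_le segment_lattice_sub) _.
apply: card_le_trans (card_image_le _ _) _.
by apply: subset_card_le => j [].
Qed.

(** [bump 1] enumerates the indices other than 1, so losing the first division point costs one in
    the count. Contrapositively, an edge with gcd + 1 lattice points yields the lattice vector (v_b
    - v_a)/gcd. *)
Lemma segment_lattice_card_lt : ~ lattice (point 1) ->
  segment (v a) (v b) `&` @lattice R d #<= `I_g.
Proof.
move=> point1; apply: card_le_trans (card_image_le (point \o bump 1) _).
apply: subset_card_le => x /segment_lattice_sub[j [/= lt_jg j_lat] <-].
have neq_1j : 1%N != j by apply: contra_notN point1 => /eqP->.
exists (unbump 1 j) => /=; last by rewrite unbumpK // inE eq_sym.
case: j lt_jg neq_1j {j_lat} => [|[|j]] // _ _.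
by have := g_gt0; rewrite ltr0n.
Qed.

(** The division points form an arithmetic progression from v_a, so they are all lattice points as
    soon as the first two are. *)
Lemma segment_lattice_card : lattice (point 1) ->
  segment (v a) (v b) `&` @lattice R d #= `I_g.+1.
Proof.
move=> point1; suff -> : segment (v a) (v b) `&` @lattice R d = point @` `I_g.+1.
  apply: inj_card_eq => i j _ _ /addrI/eqP.
  have /negPf w_neq0 : v b - v a != 0.
    by rewrite subr_eq0 eq_sym (polar_pair_neq vP neq_ab).
  rewrite -subr_eq0 -scalerBl scaler_eq0 w_neq0 orbF subr_eq0.
  have gV_neq0 : g%:R^-1 != 0 :> R by rewrite invr_eq0 gt_eqF.
  by rewrite (inj_eq (mulIf gV_neq0)) eqr_nat => /eqP.
apply/seteqP; split=> [x /segment_lattice_sub[j [? _]]|_ [j /= lt_jg <-]].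
  by exists j.
split.
  exists (j%:R / g%:R) => //=.
  by rewrite divr_ge0 // ler_pdivrMr // mul1r ler_nat -ltnS.
have -> : point j = v a + j%:R *: (point 1 - v a).
  by rewrite /point addrAC subrr add0r scalerA mul1r.
by apply: latticeD => //; apply/latticeMn/latticeD => //; apply: latticeN.
Qed.

End LatticePoints.

(** * Unimodular equivalence *)

Section Unimodular.
Variables (R : realType) (d : nat).
Implicit Types (P F : set 'rV[R]_d) (A : 'M[R]_d).

Lemma pairing_mulmxr A c x : pairing c (x *m A) = pairing (c *m A^T) x.
Proof. by rewrite !pairing_mulmx trmx_mul mulmxA. Qed.

Lemma conv_mulmx A n (p : 'I_n -> 'rV[R]_d) :
  [set x *m A | x in conv p] = conv (fun i => p i *m A).
Proof.
have combA (a : 'I_n -> R) : (\sum_i a i *: p i) *m A = \sum_i a i *: (p i *m A).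
  by rewrite mulmx_suml; apply: eq_bigr => i _; rewrite scalemxAl.
apply/seteqP; split=> [_ [_ [a [a_ge0 sum_a ->]] <-]|_ [a [a_ge0 sum_a ->]]].
  by exists a; split.
by exists (\sum_i a i *: p i); rewrite ?combA //; exists a; split.
Qed.

Lemma affine_hull_mulmx A P x :
  affine_hull P x -> affine_hull [set x *m A | x in P] (x *m A).
Proof.
move=> [n [p [a [Pp sum_a ->]]]]; exists n, (fun i => p i *m A), a; split=> // [i|].
  by exists (p i).
by rewrite mulmx_suml; apply: eq_bigr => i _; rewrite scalemxAl.
Qed.

Lemma face_mulmx A P F : A \in unitmx -> face P F ->
  face [set x *m A | x in P] [set x *m A | x in F].
Proof.
move=> A_unit [c [b [le_b ->]]].
have cE x : pairing (c *m (invmx A)^T) (x *m A) = pairing c x.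
  by rewrite -pairing_mulmxr mulmxK.
exists (c *m (invmx A)^T), b; split=> [_ [x Px <-]|].
  by rewrite cE le_b.
apply/seteqP; split=> [_ [x [Px /= cx] <-]|_ [[x Px <-] /= cx]].
  by split; [exists x|rewrite /= cE].
by exists x => //; split=> //=; rewrite -cE.
Qed.

Lemma unimodular_image (U : 'M[int]_d) P : U \in unitmx ->
  unimodularly_equivalent P [set x *m map_mx intr U | x in P].
Proof.
move=> U_unit; pose A : 'M[R]_d := map_mx intr U.
have A_unit : A \in unitmx.
  have := congr1 (map_mx intr) (mulmxV U_unit) : _ = _ :> 'M[R]_d.
  by rewrite map_mxM map_mx1 => /mulmx1_unit[].
have imK (B : 'M[R]_d) (Q : set 'rV[R]_d) : B \in unitmx ->
    [set x *m invmx B | x in [set x *m B | x in Q]] = Q.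
  move=> B_unit; apply/seteqP; split=> [_ [_ [x Qx <-] <-]|x Qx].
    by rewrite mulmxK.
  by exists (x *m B); [exists x|rewrite mulmxK].
exists U => //; split; first split.
- by move=> x /(affine_hull_mulmx A).
- by move=> x y _ _ /(can_inj (mulmxK A_unit)).
- move=> x /(affine_hull_mulmx (invmx A)); rewrite imK // => Px.
  by exists (x *m invmx A); rewrite ?mulmxKV.
apply/seteqP; split=> [_ [F faceF <-]|F faceF]; first exact: face_mulmx.
have invA_unit : invmx A \in unitmx by rewrite unitmx_inv.
have := face_mulmx invA_unit faceF; rewrite imK // => faceF'.
exists [set x *m invmx A | x in F] => //.
by have := imK _ F invA_unit; rewrite invmxK.
Qed.

End Unimodular.

(** * The weight simplex, its dual, and its recognition from lattice vectors *)

Section WeightSimplexPolar.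
Variables (R : realType) (d : nat) (Q : 'I_d.+1 -> nat).

Let k (i : 'I_d.+1) : R := (total_weight Q)%:R / (Q i)%:R.

(** One formula also covers the last vertex, because [lift ord_max l] never equals [ord_max]. *)
Lemma weight_simplex_vertexE i l :
  weight_simplex_vertex R Q i 0 l = k i *+ (i == lift ord_max l) - 1.
Proof.
have uE : (\sum_(j < d) delta_mx 0 j : 'rV[R]_d) 0 l = 1.
  rewrite summxE (bigD1 l) //= big1 ?mxE ?eqxx ?addr0 // => j /negPf neq_jl.
  by rewrite mxE eqxx eq_sym neq_jl.
rewrite /weight_simplex_vertex; case: unliftP => [j ->|->].
  by rewrite !mxE uE eqxx (inj_eq (@lift_inj _ _)) eq_sym mulr_natr.
by rewrite (negPf (neq_lift _ _)) mulr0n sub0r mxE uE.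
Qed.

(** The facet normals of S_Q: the coordinate functionals and, by the relation \sum q_i eta_i = 0
    with q_d = 1, minus the vector of the other weights. *)
Definition weight_simplex_dual_vertex (i : 'I_d.+1) : 'rV[R]_d :=
  if unlift ord_max i is Some j then delta_mx 0 j
  else - \row_j (Q (lift ord_max j))%:R.

Lemma pairing_delta j (x : 'rV[R]_d) : pairing (delta_mx 0 j) x = x 0 j.
Proof.
rewrite /pairing (bigD1 j) //= big1 => [|i /negPf neq_ij].
  by rewrite mxE !eqxx mul1r addr0.
by rewrite mxE neq_ij andbF mul0r.
Qed.

Hypotheses (Q_gt0 : forall i, (0 < Q i)%N) (Q_last : Q ord_max = 1%N).

Let Q_neq0 i : (Q i)%:R != 0 :> R.
Proof. by rewrite pnatr_eq0 -lt0n. Qed.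

Let total_gt0 : 0 < (total_weight Q)%:R :> R.
Proof. by rewrite ltr0n /total_weight (bigD1 ord_max) //= addn_gt0 Q_gt0. Qed.

Lemma weight_simplex_polar_pair :
  polar_pair (weight_simplex_vertex R Q) weight_simplex_dual_vertex k.
Proof.
split=> [i||i j].
- by rewrite divr_gt0 // ltr0n.
- under eq_bigr do rewrite /k invfM invrK mulrC.
  by rewrite -mulr_suml -natr_sum divff // gt_eqF.
rewrite /weight_simplex_dual_vertex; case: unliftP => [l ->|->].
  by rewrite pairing_delta weight_simplex_vertexE eq_sym; case: eqP => // ->.
rewrite pairingC pairingNr pairingC.
have sumQ : \sum_(l < d) (Q (lift ord_max l))%:R = (total_weight Q)%:R - 1 :> R.
  rewrite /total_weight big_ord_recr /= Q_last natrD addrK natr_sum.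
  apply: eq_bigr => l _; congr (Q _)%:R; apply: ord_inj.
  by rewrite lift_max.
have -> : pairing (\row_l (Q (lift ord_max l))%:R) (weight_simplex_vertex R Q j) =
    \sum_(l < d) (Q (lift ord_max l))%:R * (k j *+ (j == lift ord_max l)) -
    ((total_weight Q)%:R - 1).
  rewrite -sumQ -sumrB; apply: eq_bigr => l _.
  by rewrite mxE weight_simplex_vertexE mulrBr mulr1.
case: (unliftP ord_max j) => [l ->|->].
  rewrite (bigD1 l) //= eqxx big1 ?addr0 => [|m].
    rewrite (negPf (neq_lift _ _)) mulr1n mulr0n /k mulrC divfK //; ring.
  by rewrite eq_sym (inj_eq (@lift_inj _ _)) => /negPf->; rewrite mulr0.
rewrite eqxx big1 => [|l _]; last by rewrite (negPf (neq_lift _ _)) mulr0.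
rewrite /k Q_last divr1 mulr1n; ring.
Qed.

Lemma weight_simplex_vertex_lattice i :
  (forall j, Q j %| total_weight Q)%N -> lattice (weight_simplex_vertex R Q i).
Proof.
move=> Q_dvd; apply/latticeP => l; rewrite weight_simplex_vertexE rpredB ?rpred1 //.
by rewrite rpredMn // /k -natf_div // rpred_nat.
Qed.

Lemma weight_simplex_dual_vertex_lattice i : lattice (weight_simplex_dual_vertex i).
Proof.
apply/latticeP => l; rewrite /weight_simplex_dual_vertex; case: unlift => [j|].
  by rewrite mxE rpred_nat.
by rewrite !mxE rpredN rpred_nat.
Qed.

(* The matrix with columns eta_i (i < d) sends v_j to the j-th vertex of the
   weight simplex; its inverse has the rows (v_i - v_d) / k_i. *)
Lemma polar_pair_weight_simplex v eta :
    polar_pair v eta k -> (forall i, lattice (eta i)) ->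
    (forall l, lattice ((k (lift ord_max l))^-1 *: (v (lift ord_max l) - v ord_max))) ->
  unimodularly_equivalent (conv v) (@weight_simplex R d Q).
Proof.
move=> vP eta_lat e_lat; have [k_gt0 _ vE] := vP; have [_ _ etaE] := polar_pairC vP.
pose floor_mx (M : 'M[R]_d) := map_mx Num.floor M.
have floor_mxK (M : 'M[R]_d) : (forall i j, M i j \is a Num.int) ->
    map_mx intr (floor_mx M) = M.
  by move=> M_int; apply/matrixP => i j; rewrite !mxE floorK.
pose U := floor_mx (\matrix_(i, l) eta (lift ord_max l) 0 i).
pose V := floor_mx (\matrix_l
  ((k (lift ord_max l))^-1 *: (v (lift ord_max l) - v ord_max))).
have UE : map_mx intr U = \matrix_(i, l) eta (lift ord_max l) 0 i.
  by apply: floor_mxK => i l; rewrite mxE; have /latticeP := eta_lat (lift ord_max l).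
have VE : map_mx intr V = \matrix_l
    ((k (lift ord_max l))^-1 *: (v (lift ord_max l) - v ord_max)).
  by apply: floor_mxK => l i; rewrite mxE; have /latticeP := e_lat l.
(* In <eta_m, v_l - v_d> the constants -1 cancel and leave k_l [l = m]. Having an integral inverse
   makes [U] unimodular. *)
have VU : V *m U = 1%:M.
  suff /matrixP VU_R : map_mx (intr : int -> R) (V *m U) = map_mx intr 1%:M.
    by apply/matrixP => l m; have := VU_R l m; rewrite mxE [RHS]mxE => /intr_inj.
  rewrite map_mxM map_mx1 UE VE; apply/matrixP => l m.
  transitivity (pairing (eta (lift ord_max m))
      ((k (lift ord_max l))^-1 *: (v (lift ord_max l) - v ord_max))).
    by rewrite [LHS]mxE; apply: eq_bigr => i _; rewrite !mxE mulrC.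
  rewrite pairingZr pairingBr !vE [in RHS]mxE (inj_eq (@lift_inj _ _)).
  rewrite [_ == ord_max]eq_sym (negPf (neq_lift _ _)) mulr0n opprB addrA subrK subr0.
  by case: (eqVneq l m) => [->|_]; rewrite ?mulr0 // mulVf // lt0r_neq0.
have [_ U_unit] := mulmx1_unit VU.
have -> : @weight_simplex R d Q = [set x *m map_mx intr U | x in conv v].
  rewrite conv_mulmx /weight_simplex; congr conv; apply/funext => i.
  apply/rowP => l; rewrite weight_simplex_vertexE -etaE UE mxE.
  by apply: eq_bigr => j _; rewrite mxE.
exact: unimodular_image.
Qed.

End WeightSimplexPolar.

(** Let T be the product of the y_j with j != i. It clears the denominators of the other x_j, so the
    sum makes T x_i an integer; so is y_i x_i, and Bezout applies because T and y_i are coprime. *)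
Lemma int_coprime_coords (R : realType) n (y : 'I_n -> nat) (x : 'I_n -> R) :
    (forall i j, i != j -> coprime (y i) (y j)) -> (forall i, (0 < y i)%N) ->
    (forall i, (y i)%:R * x i \is a Num.int) -> \sum_i x i \is a Num.int ->
  forall i, x i \is a Num.int.
Proof.
move=> y_coprime y_gt0 yx_int sum_int i.
pose T := (\prod_(j | j != i) y j)%N.
have T_coprime : coprime T (y i).
  by rewrite /T; elim/big_ind: _ => [|m p mi pi|j /y_coprime //];
    rewrite ?coprime1n ?coprimeMl ?mi.
have Tx_int : T%:R * x i \is a Num.int.
  have -> : T%:R * x i = T%:R * \sum_j x j - \sum_(j | j != i) T%:R * x j.
    by rewrite -mulr_sumr -mulrBr (bigD1 i) //= addrK.
  rewrite rpredB ?rpredM ?rpred_nat //; apply: rpred_sum => j neq_ji.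
  rewrite /T (bigD1 j) //= mulnC natrM -mulrA rpredM ?rpred_nat //.
have T_gt0 : (0 < T)%N by apply: prodn_gt0.
have [u w uw _] := egcdnP (y i) T_gt0.
have -> : x i = u%:R * (T%:R * x i) - w%:R * ((y i)%:R * x i).
  rewrite !mulrA -mulrBl -!natrM uw (eqP T_coprime) natrD addrAC subrr add0r mul1r //.
by rewrite rpredB // rpredM // rpred_nat.
Qed.

Lemma enlarged_sylvester_ratio (R : realType) d (i : 'I_d.+1) : (0 < d)%N ->
  (total_weight (@enlarged_sylvester d))%:R / (enlarged_sylvester i)%:R =
  (if (i < d.-1)%N then sylvester i else (2 * sylvester_t d.-1)%N)%:R :> R.
Proof.
move=> d_gt0; rewrite -natf_div ?pnatr_eq0 -?lt0n ?enlarged_sylvester_gt0 //; last first.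
  exact: enlarged_sylvester_dvd.
rewrite enlarged_sylvester_total // /enlarged_sylvester; congr (_%:R).
case: ifP => [lt_id|_]; last by rewrite divn1.
have dvd_y : (sylvester i %| 2 * sylvester_t d.-1)%N by rewrite dvdn_mull // sylvester_dvd.
rewrite -{1}(divnK dvd_y) mulKn // divn_gt0 ?sylvester_gt0 // dvdn_leq //.
by rewrite muln_gt0 sylvester_t_gt0.
Qed.

(** Put e_l = (v_l - v_d)/k_l. The last hypothesis settles e_(d-1). For l < d-1 the vector y_l e_l =
    v_l - v_d is a lattice vector, and since the sum of all e_l is one too, coprimality of the y_l
    settles the rest coordinatewise. *)
Lemma sylvester_polar_pair_unimodular (R : realType) n
    (v eta : 'I_n.+2 -> 'rV[R]_n.+1) :
    polar_pair v eta (fun i =>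
      (total_weight (@enlarged_sylvester n.+1))%:R / (enlarged_sylvester i)%:R) ->
    (forall i, lattice (v i)) -> (forall i, lattice (eta i)) ->
    lattice ((2 * sylvester_t n)%:R^-1 *: (v ord_max - v (inord n))) ->
  unimodularly_equivalent (conv v) (@weight_simplex R n.+1 (@enlarged_sylvester n.+1)).
Proof.
move=> vP v_lat eta_lat last_lat.
apply: (polar_pair_weight_simplex vP eta_lat).
set k := fun i : 'I_n.+2 => _ in vP *.
pose e l : 'rV[R]_n.+1 := (k (lift ord_max l))^-1 *: (v (lift ord_max l) - v ord_max).
have kE i : k i = (if (i < n)%N then sylvester i else (2 * sylvester_t n)%N)%:R.
  exact: enlarged_sylvester_ratio.
have e_last : lattice (e ord_max).
  have -> : e ord_max = - ((2 * sylvester_t n)%:R^-1 *: (v ord_max - v (inord n))).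
    rewrite /e kE lift_max ltnn -scalerN opprB; congr (_ *: (v _ - _)).
    by apply: ord_inj; rewrite lift_max /= inordK.
  exact: latticeN.
(* Substituting \sum v_i/k_i = 0 and \sum 1/k_i = 1 eliminates every vertex but v_d. *)
have sum_e : \sum_l e l = - v ord_max.
  have [_ sum_k _] := vP; have origin := polar_pair_origin vP.
  rewrite (bigD1_ord ord_max) //= in sum_k; move/(canRL (addKr _)): sum_k => sum_k.
  rewrite (bigD1_ord ord_max) //= in origin; move/(canRL (addKr _)): origin => origin.
  under eq_bigr do rewrite /e scalerBr.
  rewrite sumrB origin -scaler_suml sum_k addr0 scalerDl scaleNr scale1r.
  by rewrite opprD opprK addKr.
have e_lat l i : e (lift ord_max l) 0 i \is a Num.int.
  move: l; apply: (@int_coprime_coords _ _ (fun l : 'I_n => sylvester l)) => [l m||l|].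
  - exact: sylvester_coprime.
  - by move=> l; apply: sylvester_gt0.
  - rewrite /e mxE kE !lift_max ltn_ord mulrA divff ?mul1r.
      by have /latticeP :=
        latticeD (v_lat (lift ord_max (lift ord_max l))) (latticeN (v_lat ord_max)).
    by rewrite pnatr_eq0 -lt0n sylvester_gt0.
  move: sum_e; rewrite (bigD1_ord ord_max) //= => /(canRL (addKr _)).
  move=> /(congr1 (fun x : 'rV_n.+1 => x 0 i)); rewrite summxE => ->.
  by have /latticeP := latticeD (latticeN e_last) (latticeN (v_lat ord_max)).
move=> l; apply/latticeP => i; case: (unliftP ord_max l) => [j ->|->]; first exact: e_lat.
by have /latticeP := e_last.
Qed.

(** * The edge bound, an edge attaining it, and uniqueness of the extremal simplex *)

Theorem theoremB (R : realType) (d : nat) (hd : (2 <= d)%N) :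
  [/\ forall P E : set 'rV[R]_d, reflexive_simplex P -> edge P E ->
        E `&` @lattice R d #<= `I_(2 * sylvester_t (d - 1) + 1)%N,
      reflexive_simplex (@weight_simplex R d (@enlarged_sylvester d)) /\
      (exists2 E : set 'rV[R]_d,
        edge (@weight_simplex R d (@enlarged_sylvester d)) E &
        E `&` @lattice R d #= `I_(2 * sylvester_t (d - 1) + 1)%N)
    & forall P : set 'rV[R]_d, reflexive_simplex P ->
        (exists2 E : set 'rV[R]_d, edge P E &
          E `&` @lattice R d #= `I_(2 * sylvester_t (d - 1) + 1)%N) ->
        unimodularly_equivalent P
          (@weight_simplex R d (@enlarged_sylvester d))].
Proof.
case: d hd => [//|n] _; rewrite subn1 addn1 /=; set t := sylvester_t n.
have k_gt0 v eta (k : 'I_n.+2 -> nat) :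
    polar_pair v eta (fun i => (k i)%:R : R) -> forall i, (0 < k i)%N.
  by move=> [k_gt0 _ _] i; rewrite -(ltr0n R).
split.
- move=> P E /reflexive_simplex_polar_pair[v [eta [k [vP v_lat eta_lat ->]]]].
  move=> /(edge_conv_segment vP)[a [b [neq_ab ->]]].
  have [_ sum_k _] := vP.
  have [gcd_le _] := gcdn_le_sylvester (k_gt0 _ _ _ vP) sum_k neq_ab.
  apply: card_le_trans (segment_lattice_card_le vP eta_lat neq_ab) _.
  by rewrite card_le_II ltnS.
- have Q_gt0 := @enlarged_sylvester_gt0 n.+1.
  have wP := weight_simplex_polar_pair R Q_gt0 (enlarged_sylvester_last _).
  have w_lat i : lattice (weight_simplex_vertex R (@enlarged_sylvester n.+1) i).
    by apply: weight_simplex_vertex_lattice => // j; apply: enlarged_sylvester_dvd.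
  have u_lat := @weight_simplex_dual_vertex_lattice R n.+1 (@enlarged_sylvester n.+1).
  split; first exact: polar_pair_reflexive_simplex wP w_lat u_lat.
  have neq_ab : inord n != ord_max :> 'I_n.+2.
    by rewrite -val_eqE /= inordK // neq_ltn ltnSn.
  (* The weights with indices d-1 and d are both 1, so both endpoints have k = 2t, and the gcd is 2t
     as well. *)
  exists (segment (weight_simplex_vertex R (@enlarged_sylvester n.+1) (inord n))
    (weight_simplex_vertex R (@enlarged_sylvester n.+1) ord_max)).
    exact: conv_segment_edge wP _ _ neq_ab.
  pose k (i : 'I_n.+2) := if (i < n)%N then sylvester i else (2 * t)%N.
  have kE : (fun i => (total_weight (@enlarged_sylvester n.+1))%:R /
      (enlarged_sylvester i)%:R : R) = (fun i => (k i)%:R).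
    by apply/funext => i; apply: enlarged_sylvester_ratio.
  rewrite kE in wP.
  have ka : k (inord n) = (2 * t)%N by rewrite /k inordK // ltnn.
  have kb : k ord_max = (2 * t)%N by rewrite /k /= ltnNge leqnSn.
  have := segment_lattice_card wP w_lat u_lat neq_ab; rewrite ka kb gcdnn; apply.
  (* The first division point is v_(d-1) plus (v_d - v_(d-1))/(2t) = -e_(d-1), a lattice vector. *)
  apply: latticeD => //; apply/latticeP => l.
  have inord_lift : inord n = lift ord_max ord_max :> 'I_n.+2.
    by apply: ord_inj; rewrite lift_max inordK.
  have t2_neq0 : (2 * t)%:R != 0 :> R by rewrite pnatr_eq0 -lt0n muln_gt0 sylvester_t_gt0.
  rewrite mxE [X in _ * X]mxE [X in _ + X]mxE !weight_simplex_vertexE.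
  rewrite !enlarged_sylvester_ratio // inord_lift lift_max ltnn.
  rewrite (negPf (neq_lift _ _)) mulr0n opprB addrA subrK sub0r mulrN.
  by rewrite rpredN mul1r mulrnAr mulVf // rpredMn ?rpred1.
move=> P /reflexive_simplex_polar_pair[v [eta [k [vP v_lat eta_lat ->]]]].
move=> [E /(edge_conv_segment vP)[a [b [neq_ab ->]]]] cardE.
have [_ sum_k _] := vP.
have [gcd_le gcd_eq] := gcdn_le_sylvester (k_gt0 _ _ _ vP) sum_k neq_ab.
(* The 2t + 1 lattice points are at most gcd + 1 in number, which is the inequality opposite to
   [gcd_le]. *)
have gE : gcdn (k a) (k b) = (2 * t)%N.
  apply/eqP; rewrite eqn_leq gcd_le -ltnS -card_le_II.
  rewrite -(card_le_eql cardE).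
  exact: (segment_lattice_card_le vP eta_lat neq_ab).
(* Were this vector outside the lattice, the edge would have at most 2t lattice points. *)
have last_lat : lattice ((2 * t)%:R^-1 *: (v b - v a)).
  have : ~~ (`I_(2 * t).+1 #<= `I_(2 * t)) by rewrite card_le_II ltnn.
  rewrite -(card_le_eql cardE); apply: contraNP => nlat; rewrite -gE.
  apply: (segment_lattice_card_lt vP eta_lat neq_ab); rewrite gE mul1r => point1.
  apply: nlat; have := latticeD point1 (latticeN (v_lat a)).
  by rewrite addrAC subrr add0r.
have [s [s_inj sa sb sE]] := gcd_eq gE.
(* Relabelling by [s] puts the k_i in the order of Q'_d, with [a] and [b] at the positions d-1 and
   d. *)
rewrite -(conv_perm v s_inj).
apply: (@sylvester_polar_pair_unimodular _ _ _ (eta \o s)) => /=.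
- have := polar_pair_perm s_inj vP.
  suff -> : (fun i => (k i)%:R) \o s = (fun i =>
      (total_weight (@enlarged_sylvester n.+1))%:R / (enlarged_sylvester i)%:R : R) by [].
  by apply/funext => i; rewrite /= sE enlarged_sylvester_ratio.
- by move=> i; apply: v_lat.
- by move=> i; apply: eta_lat.
by rewrite sa sb.
Qed.
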